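(* Let $\varrho\colon\mathcal{A}\to\mathcal{A}^R$ be an aperiodic, primitive, bijective block substitution, where $R=\prod_{i=1}^d[0,L_i-1]\subset\mathbb{Z}^d$ with all $L_i\geqslant 2$, and let $Q=\mathrm{diag}(L_1,\dots,L_d)$. Let $A\in W_d$. Put $\boldsymbol{v}=\frac12(1,\dots,1)^T$, $\boldsymbol{x}_1=Q\boldsymbol{v}-\boldsymbol{v}$, and assume that $AQ=QA$ and $|A|\boldsymbol{x}_1=\boldsymbol{x}_1$, where $(|A|)_{ij}=|A_{ij}|$. Let $A^{(1)}\colon R\to R$ be the map $$A^{(1)}(\boldsymbol{i})=A(\boldsymbol{i}-\boldsymbol{x}_1)+|A|\boldsymbol{x}_1 .$$ Suppose there exists $\boldsymbol{\ell}\in R$ such that $\varrho_{\boldsymbol{\ell}'}=\mathrm{id}$ for all $\boldsymbol{\ell}'$ in the orbit $\mathrm{Orb}_A(\boldsymbol{\ell})=\{(A^{(1)})^k(\boldsymbol{\ell}) : k\geqslant 0\}$. Let $\pi$ be a permutation of $\mathcal{A}$. Then $\pi$, together with $A$, gives rise to an extended symmetry $f\in\mathcal{R}(\mathbb{X}_\varrho)$ (that is, the map given by $f(x)_{\boldsymbol{n}}=\pi(x_{A\boldsymbol{n}})$, up to composition with a shift, defines an element of $\mathcal{R}(\mathbb{X}_\varrho)$) if and only if $$\pi^{-1}\circ\varrho_{\boldsymbol{i}}\circ\pi=\varrho_{A^{(1)}(\boldsymbol{i})}\qquad\text{for all }\boldsymbol{i}\in R.$$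
   Context: $W_d\leqslant\mathrm{GL}(d,\mathbb{Z})$ is the hyperoctahedral group of all $d\times d$ signed permutation matrices. Let $\mathcal{A}$ be a finite alphabet and $R=\prod_{i=1}^d[0,L_i-1]\subset\mathbb{Z}^d$. A block (rectangular) substitution is a map $\varrho\colon\mathcal{A}\to\mathcal{A}^R$, extended to patterns $P$ on finite subsets of $\mathbb{Z}^d$ by $\varrho(P)_{Q\boldsymbol{n}+\boldsymbol{r}}=\varrho(P_{\boldsymbol{n}})_{\boldsymbol{r}}$ for $\boldsymbol{r}\in R$, with $Q=\mathrm{diag}(L_1,\dots,L_d)$; thus $\varrho^k(a)$ is a pattern of shape $\prod_i[0,L_i^k-1]$. It is primitive if for some $k\geqslant1$ every $\varrho^k(a)$ contains every letter. Its columns are the maps $\varrho_{\boldsymbol{i}}\colon\mathcal{A}\to\mathcal{A}$, $\varrho_{\boldsymbol{i}}(a)=\varrho(a)_{\boldsymbol{i}}$, $\boldsymbol{i}\in R$; $\varrho$ is bijective if every column is a bijection. The hull $\mathbb{X}_\varrho\subseteq\mathcal{A}^{\mathbb{Z}^d}$ is the set of all $x\in\mathcal{A}^{\mathbb{Z}^d}$ all of whose finite patterns occur (up to translation) in some $\varrho^k(a)$; it carries the product topology and the shift action $(\sigma_{\boldsymbol{n}}(x))_{\boldsymbol{m}}=x_{\boldsymbol{n}+\boldsymbol{m}}$ of $\mathbb{Z}^d$. It (and $\varrho$) is aperiodic if no $x\in\mathbb{X}_\varrho$ satisfies $\sigma_{\boldsymbol{n}}(x)=x$ for some $\boldsymbol{n}\neq\boldsymbol{0}$.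 The extended symmetry group $\mathcal{R}(\mathbb{X}_\varrho)$ is the normaliser of $\mathcal{G}=\{\sigma_{\boldsymbol{n}}:\boldsymbol{n}\in\mathbb{Z}^d\}$ in the group of all self-homeomorphisms of $\mathbb{X}_\varrho$. *)

(* Defs.v *)
From HB Require Import structures.
From mathcomp Require Import all_boot all_order all_algebra all_fingroup.
From mathcomp Require Import all_classical topology function_spaces.
From mathcomp Require Import zify ring.

Set Implicit Arguments.
Unset Strict Implicit.
Unset Printing Implicit Defensive.

Import Order.TTheory GRing.Theory Num.Theory.

Local Open Scope classical_set_scope.
Local Open Scope ring_scope.

(* Z^d is 'cV[int]_d.  Half-integral vectors live in 'cV[rat]_d, into which
   integral vectors and matrices are embedded by [ratmx]. *)
Definition ratmx m n (M : 'M[int]_(m, n)) : 'M[rat]_(m, n) := map_mx intr M.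

Definition absmx m n (M : 'M[int]_(m, n)) : 'M[int]_(m, n) := map_mx Num.norm M.

Definition hyperoctahedral d : set 'M[int]_d :=
  [set M | exists (s : 'S_d) (e : 'I_d -> bool),
     M = \matrix_(i, j) if j == s i then (-1) ^+ e i else 0].

Arguments hyperoctahedral d : clear implicits.

Section BlockSubstitutions.
Context {d : nat} {Al : finType} (L : 'I_d -> nat).

Definition in_block (r : 'cV[int]_d) : bool :=
  [forall i, 0 <= r i 0 < (L i)%:Z].

Definition block : Type := {r : 'cV[int]_d | in_block r}.

Definition Qmx : 'M[int]_d := diag_mx (\row_i (L i)%:Z).

Definition x1 : 'cV[rat]_d :=
  let v := const_mx (1 / 2) in ratmx Qmx *m v - v.

Lemma block_symmetry_subproof (M : 'M[int]_d) :
  hyperoctahedral d M -> ratmx (absmx M) *m x1 = x1 ->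
  forall i : block, exists j : block,
    ratmx (val j) == ratmx M *m (ratmx (val i) - x1) + ratmx (absmx M) *m x1.
Proof.
move=> [s [e defM]] absM [i /= /forallP hi].
have x1E k : x1 k 0 = (L k)%:R / 2 - 1 / 2.
  by rewrite /x1 /ratmx /Qmx map_diag_mx mul_diag_mx !mxE mul1r.
have mulM (u : 'cV[rat]_d) k : (ratmx M *m u) k 0 = (-1) ^+ e k * u (s k) 0.
  rewrite mxE (bigD1 (s k)) //= big1 ?addr0 => [|j jk]; rewrite defM !mxE.
    by rewrite eqxx rmorphXn/= rmorphN1.
  by rewrite (negPf jk) mul0r.
have mulabs (u : 'cV[rat]_d) k : (ratmx (absmx M) *m u) k 0 = u (s k) 0.
  rewrite mxE (bigD1 (s k)) //= big1 ?addr0 => [|j jk]; rewrite defM !mxE.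
    by rewrite eqxx normrX normrN1 expr1n mul1r.
  by rewrite (negPf jk) normr0 mul0r.
have Ls k : L (s k) = L k.
  have := congr1 (fun u : 'cV_d => u k 0) absM.
  rewrite /= mulabs !x1E => /addIr /(mulIf _) -/(_ isT) /eqP.
  by rewrite eqr_nat => /eqP.
pose j : 'cV[int]_d :=
  \col_k if e k then (L k)%:Z - 1 - i (s k) 0 else i (s k) 0.
have jP : in_block j.
  apply/forallP => k; rewrite mxE; have := hi (s k); rewrite Ls.
  by case: (e k) => // /andP[? ?]; lia.
exists (exist _ j jP); apply/eqP/colP => k /=.
have addE (u v : 'cV[rat]_d) : (u + v) k 0 = u k 0 + v k 0 by rewrite mxE.
have subE (u v : 'cV[rat]_d) : (u - v) (s k) 0 = u (s k) 0 - v (s k) 0.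
  by rewrite !mxE.
rewrite addE mulM mulabs subE x1E Ls !mxE.
case: (e k); rewrite /= ?expr1 ?expr0 ?mulN1r ?mul1r.
  by rewrite !intrB -pmulrn; field.
by rewrite subrK.
Qed.

(* The element of R given by [block_symmetryE]; it is unique because [ratmx] is
   injective. *)
Definition block_symmetry (M : 'M[int]_d) (hM : hyperoctahedral d M)
    (hx1 : ratmx (absmx M) *m x1 = x1) (i : block) : block :=
  xchoose (block_symmetry_subproof hM hx1 i).

Lemma block_symmetryE M hM hx1 i :
  ratmx (val (@block_symmetry M hM hx1 i))
    = ratmx M *m (ratmx (val i) - x1) + ratmx (absmx M) *m x1.
Proof. exact/eqP/(xchooseP (block_symmetry_subproof hM hx1 i)). Qed.

Variable rho : Al -> block -> Al.

Definition column (i : block) (a : Al) : Al := rho a i.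

Definition bijective_subst : Prop := forall i, bijective (column i).

(* A pattern is encoded by its graph, a set of pairs (position, letter);
   a letter a is the pattern {(0, a)}. *)
Definition pattern : Type := set ('cV[int]_d * Al).

Definition inflate (P : pattern) : pattern :=
  [set (Qmx *m p.1 + val r, rho p.2 r) | p in P & r in [set: block]].

Definition supertile (k : nat) (a : Al) : pattern :=
  iter k inflate [set (0, a)].

Definition primitive_subst : Prop :=
  exists2 k : nat, (1 <= k)%N & forall a b, exists n, supertile k a (n, b).

Definition config : Type :=
  prod_topology (fun _ : 'cV[int]_d => discrete_topology Al).
HB.instance Definition _ := Topological.on config.

Definition shift (n : 'cV[int]_d) (x : config) : config := fun m => x (n + m).

Definition hull : set config :=
  [set x | forall S : set 'cV[int]_d, finite_set S ->
     exists (k : nat) (a : Al) (t : 'cV[int]_d),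
       forall n, S n -> supertile k a (t + n, x n)].

Definition aperiodic : Prop :=
  forall x, hull x -> forall n, shift n x = x -> n = 0.

Lemma hull_shift n x : hull x -> hull (shift n x).
Proof.
move=> hx S finS.
have [k [a [t ht]]] := hx _ (finite_image (fun m => n + m) finS).
exists k, a, (t + n) => m Sm.
by rewrite -addrA; apply: ht; exists m.
Qed.

Definition hull_shift_map (n : 'cV[int]_d) (x : hull) : hull :=
  exist _ (shift n (val x)) (mem_set (hull_shift n (set_valP x))).

Definition shift_group : set (hull -> hull) := range hull_shift_map.

End BlockSubstitutions.

Arguments shift_group {d Al L} rho.

(* The normaliser of G in the group of self-homeomorphisms of X. *)
Definition homeo_normaliser (X : topologicalType) (G : set (X -> X)) :
    set (X -> X) :=
  [set f | exists g : X -> X, [/\ continuous f, continuous g,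
     cancel f g, cancel g f & [set f \o s \o g | s in G] = G]].

Definition extended_symmetries d (Al : finType) (L : 'I_d -> nat)
    (rho : Al -> block L -> Al) : set (hull rho -> hull rho) :=
  homeo_normaliser (shift_group rho).

Arguments extended_symmetries {d Al L} rho.

Definition relabel d (Al : finType) (pi : Al -> Al) (M : 'M[int]_d)
    (x : config) : @config d Al := fun n => pi (x (M *m n)).

Definition induces_extended_symmetry d (Al : finType) (L : 'I_d -> nat)
    (rho : Al -> block L -> Al) (pi : {perm Al}) (M : 'M[int]_d) : Prop :=
  exists (m : 'cV[int]_d) (f : hull rho -> hull rho),
    extended_symmetries rho f /\
    forall x : hull rho, val (f x) = shift m (relabel pi M (val x)).

(* Main.v *)
(* If the columns are conjugate, then the n-th letter of rho^k(pi a) is the image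
   under pi of the letter of rho^k(a) at A n + c_k, with c_(k+1) = Q c_k + c_1 and
   c_1 = |A| x_1 - A x_1, so relabelling maps patterns of supertiles to patterns of
   supertiles, in both directions.
   Conversely, choose for a letter b some y in the hull with y_0 = b.  The image of
   rho(y) lies in the hull, so it is a shift of some rho(y').  Comparing the two
   cuts into blocks leaves a phase delta in R.  If delta had a nonzero coordinate
   i, then two suitable columns would express the same letter of y' through the
   letters of y at two positions that differ by e_i; thus y would be, up to a
   permutation of the letters, invariant under e_i, and therefore periodic.  So
   delta = 0, which says that rho_r^-1 pi rho_(A1 r) takes the same value at b for
   every r; the columns at l and A1 l show that this value is pi b.  Recognizability
   is never needed. *)
Require Import Defs.
From mathcomp Require Import all_boot all_order all_algebra all_fingroup.
From mathcomp Require Import all_classical topology function_spaces.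
From mathcomp Require Import zify.

Set Implicit Arguments.
Unset Strict Implicit.
Unset Printing Implicit Defensive.

Import Order.TTheory GRing.Theory Num.Theory.
Local Open Scope ring_scope.

Lemma ltz_digit {b r : int} (m n : int) :
  0 <= r < b -> (b * m + r < b * n) = (m < n).
Proof.
move=> hr; case: (ltP m n) => mn; last apply/negbTE.
  have : b * (m + 1) <= b * n by apply: ler_wpM2l; lia.
  lia.
have : b * n <= b * m by apply: ler_wpM2l; lia.
lia.
Qed.

(** * Block decomposition of Z^d and supertiles *)

Section Supertiles.
Context {d : nat} {Al : finType} {L : 'I_d -> nat}.
Variable rho : Al -> block L -> Al.
Hypothesis L_ge2 : forall i, (2 <= L i)%N.

Local Notation Q := (Qmx L).

Lemma Qmx_mulE (v : 'cV[int]_d) i : (Q *m v) i 0 = (L i)%:Z * v i 0.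
Proof. by rewrite mul_diag_mx !mxE. Qed.

Lemma blockP (r : block L) i : 0 <= val r i 0 < (L i)%:Z.
Proof. by case: r => r /= /forallP. Qed.

Lemma block_decomposition (n : 'cV[int]_d) :
  exists (m : 'cV[int]_d) (r : block L), n = Q *m m + val r.
Proof.
have rP : in_block L (\col_i modz (n i 0) (L i)).
  apply/forallP => i; rewrite mxE modz_ge0 /=; last by have := L_ge2 i; lia.
  by rewrite ltz_pmod //; have := L_ge2 i; lia.
exists (\col_i divz (n i 0) (L i)), (exist (fun r : 'cV_d => in_block L r) _ rP).
by apply/colP => i; rewrite /= mxE Qmx_mulE !mxE mulrC -divz_eq.
Qed.

Lemma block_decomposition_inj {m m' : 'cV[int]_d} {r r' : block L} :
  Q *m m + val r = Q *m m' + val r' -> m = m' /\ r = r'.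
Proof.
move=> e; have mm' : m = m'.
  apply/colP => i; have := congr1 (fun u : 'cV_d => u i 0) e.
  rewrite /= [LHS]mxE [RHS]mxE !Qmx_mulE; have := blockP r i.
  have := blockP r' i; move: (m i 0) (m' i 0) (val r i 0) (val r' i 0).
  move=> u v s t hs ht e'.
  have := ltz_digit u v ht; have := ltz_digit v u hs; lia.
by split=> //; apply: val_inj; move: e; rewrite mm' => /addrI.
Qed.

Lemma inflateP k a m (r : block L) b :
  supertile rho k.+1 a (Q *m m + val r, b) <->
  exists2 c, supertile rho k a (m, c) & b = rho c r.
Proof.
split=> [[[m' c] h [r' _ [e <-]]]|[c h ->]].
  by have [<- <-] := block_decomposition_inj e; exists c.
by exists (m, c) => //; exists r.
Qed.

Lemma supertile_functional k a n b b' :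
  supertile rho k a (n, b) -> supertile rho k a (n, b') -> b = b'.
Proof.
elim: k n b b' => [|k IHk] n b b'; first by move=> [_ ->] [_ ->].
have [m [r ->]] := block_decomposition n.
by move=> /inflateP[c hc ->] /inflateP[c' /(IHk _ _ _ hc) -> ->].
Qed.

Lemma supertile_total k a (n : 'cV[int]_d) :
  (forall i, 0 <= n i 0 < (L i)%:Z ^+ k) -> exists b, supertile rho k a (n, b).
Proof.
elim: k n => [|k IHk] n hn.
  exists a; congr (_, _); apply/colP => i; have := hn i.
  by rewrite expr0 mxE -[_ = _]/((n i 0)%R = 0 :> int); lia.
have [m [r en]] := block_decomposition n.
have [|c hc] := IHk m.
  move=> i; have := hn i; rewrite en [X in 0 <= X < _]mxE Qmx_mulE exprS.
  have hr := blockP r i.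
  by rewrite !leNgt -{1}(mulr0 (L i)%:Z) !(ltz_digit _ _ hr).
by exists (rho c r); rewrite en; apply/inflateP; exists c.
Qed.

(** [supertile] adds inflations on the outside; here the innermost one is split off instead, so that
    a letter at r in rho(a) grows into a supertile at Q^k r. *)
Lemma supertile_nested k a (r : block L) n b :
  supertile rho k (rho a r) (n, b) ->
  supertile rho k.+1 a (iter k (mulmx Q) (val r) + n, b).
Proof.
elim: k n b => [|k IHk] n b.
  case=> -> ->; rewrite /= addr0.
  have := (@inflateP 0 a 0 r (rho a r)).2; rewrite mulmx0 add0r.
  by apply; exists a.
have [m [s ->]] := block_decomposition n.
move=> /inflateP[c /IHk hc ->]; rewrite addrA iterS -mulmxDr.
by apply/inflateP; exists c.
Qed.

Lemma block0P : in_block L 0.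
Proof. by apply/forallP => i; rewrite mxE /=; have := L_ge2 i; lia. Qed.

Definition block0 : block L := exist _ 0 block0P.

Lemma blockmaxP : in_block L (\col_i ((L i)%:Z - 1)).
Proof. by apply/forallP => i; rewrite mxE /=; have := L_ge2 i; lia. Qed.

Definition blockmax : block L := exist (fun r : 'cV_d => in_block L r) _ blockmaxP.

Lemma supertile_extend k a n b :
  supertile rho k (rho a block0) (n, b) -> supertile rho k.+1 a (n, b).
Proof.
move=> /supertile_nested; congr (supertile _ _ _ (_, _)).
suff -> : iter k (mulmx Q) (val block0) = 0 by rewrite add0r.
by elim: k => //= k ->; rewrite mulmx0.
Qed.

Lemma hull_subst (x y : @config d Al) :
  (forall m (r : block L), x (Q *m m + val r) = rho (y m) r) ->
  hull rho y -> hull rho x.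
Proof.
move=> xy hy S finS.
have [q hq] := choice block_decomposition.
have [k [a [t ht]]] := hy _ (finite_image q finS).
exists k.+1, a, (Q *m t) => n Sn; have [r {1 2}->] := hq n.
rewrite addrA -mulmxDr xy; apply/inflateP.
by exists (y (q n)) => //; apply: ht; exists n.
Qed.

Lemma subst_exists (y : @config d Al) : exists x : @config d Al,
  forall m (r : block L), x (Q *m m + val r) = rho (y m) r.
Proof.
have [q hq] := choice block_decomposition.
have [r hr] := choice hq.
exists (fun n => rho (y (q n)) (r n)) => m s.
by have [<- <-] := block_decomposition_inj (hr (Q *m m + val s)).
Qed.

Lemma finite_block : finite_set [set: block L].
Proof.
pose M := (\max_i L i)%N.
pose F (g : {ffun 'I_d -> 'I_M.+1}) : 'cV[int]_d := \col_i (g i : nat)%:Z.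
(* Digit vectors outside R fall back to [block0]; only surjectivity onto R matters. *)
pose G g : block L := insubd block0 (F g).
apply: (@sub_finite_set _ _ (range G)); last exact/finite_image/finite_finset.
move=> r _ ; exists [ffun i => inord (absz (val r i 0))] => //.
rewrite /G (_ : F _ = val r) ?valKd //.
apply/colP => i; rewrite mxE ffunE inordK; have := blockP r i; first by lia.
have : (L i <= M)%N by rewrite leq_bigmax.
lia.
Qed.

(** * Points of the hull when the columns are bijective *)

Hypothesis rho_bij : bijective_subst rho.

Lemma hull_desubst {x : @config d Al} : hull rho x ->
  exists (t : 'cV[int]_d) (y : @config d Al),
    forall m (r : block L), x (t + (Q *m m + val r)) = rho (y m) r.
Proof.
move=> hx.
(* If every phase c failed at some m c, the finite set of these blocks would not
   occur in any supertile, since the position of an occurrence has a phase. *)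
suff [c hc] : exists c : block L, forall m, exists b, forall r : block L,
    x (- val c + (Q *m m + val r)) = rho b r.
  by have [y hy] := choice hc; exists (- val c), y.
apply: contrapT => /forallNP H.
have {}H c := (existsNP _).2 (H c).
have [m hm] := choice H.
pose S : set 'cV[int]_d := [set - val c + (Q *m m c + val r) |
  c in [set: block L] & r in [set: block L]]%classic.
have [] := hx S.
  exact: finite_image2 finite_block finite_block.
move=> k [a' [t ht]].
(* A supertile of level 0 has no blocks, so the occurrence is lifted to level k + 1, using a letter
   a whose image has a' at the digit 0. *)
have [inv _ invK] := rho_bij block0.
pose a := inv a'.
have {}ht n : S n -> supertile rho k.+1 a (t + n, x n).
  by move=> /ht h; apply: supertile_extend; rewrite -[rho _ _]/(column rho _ _) invK.
have [q [c et]] := block_decomposition t.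
have hS (r : block L) : supertile rho k.+1 a (Q *m (q + m c) + val r,
    x (- val c + (Q *m m c + val r))).
  have /ht : S (- val c + (Q *m m c + val r)) by exists c => //; exists r.
  by rewrite {1}et mulmxDr -!addrA addNKr.
apply: (hm c).
have /inflateP[b hb _] := hS block0.
exists b => r; have /inflateP[b' hb' ->] := hS r.
by rewrite (supertile_functional hb hb').
Qed.

Lemma iter_Qmx k (v : 'cV[int]_d) i :
  iter k (mulmx Q) v i 0 = (L i)%:Z ^+ k * v i 0.
Proof.
by elim: k => [|k IHk]; rewrite ?mul1r //= Qmx_mulE IHk mulrA exprS.
Qed.

(* Two inflation steps enclose a supertile in a larger one, extending it to the
   right by the digit [block0] and to the left by the digit [blockmax]; [origin]
   is the position of the initial letter after [s] such double steps. *)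
Definition origin s : 'cV[int]_d :=
  \sum_(t < s) iter t.*2.+1 (mulmx Q) (val blockmax).

Lemma originS s : origin s.+1 =
  iter s.*2.+1 (mulmx Q) (val blockmax) + origin s.
Proof. by rewrite /origin big_ord_recr addrC. Qed.

(** The distance from the initial letter to every face of the supertile grows with s, so the
    recentred supertiles exhaust Z^d. *)
Lemma origin_bounds s i :
  s%:Z <= origin s i 0 < (L i)%:Z ^+ s.*2 - s%:Z.
Proof.
elim: s => [|s IHs]; first by rewrite /origin big_ord0 mxE.
rewrite originS [X in _ <= X < _]mxE iter_Qmx mxE doubleS !exprSr; move: IHs.
have := L_ge2 i.
have : 0 < (L i)%:Z ^+ s.*2 by rewrite exprn_gt0 //; have := L_ge2 i; lia.
move: (_ ^+ _) (origin s i 0) => u p; nia.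
Qed.

(** [next] inverts the two columns used in a double step, so the supertiles [T s], recentred at
    [origin s], extend each other; y is their union. *)
Lemma hull_letter (b : Al) : exists2 y : @config d Al, hull rho y & y 0 = b.
Proof.
have [next nextE] : exists next : Al -> Al,
    forall a, rho (rho (next a) blockmax) block0 = a.
  have [g _ gK] := rho_bij block0; have [h _ hK] := rho_bij blockmax.
  by exists (h \o g) => a; have := gK a; rewrite -{1}(hK (g a)).
pose T s := supertile rho s.*2 (iter s next b).
have TS s (n : 'cV[int]_d) c : T s (origin s + n, c) -> T s.+1 (origin s.+1 + n, c).
  rewrite /T -{1}[iter s next b]nextE doubleS.
  move=> /supertile_extend /supertile_nested.
  by rewrite addrA -originS.
have Tmon s t (n : 'cV[int]_d) c : (s <= t)%N ->
    T s (origin s + n, c) -> T t (origin t + n, c).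
  by move=> /subnK <-; elim: (t - s)%N => // k IHk /IHk; apply: TS.
have Ttot (n : 'cV[int]_d) : exists s c, T s (origin s + n, c).
  pose s := (\max_i absz (n i ord0)).+1; exists s.
  apply: supertile_total => i; rewrite [X in 0 <= X < _]mxE.
  have : (absz (n i ord0) < s)%N by rewrite ltnS (leq_bigmax i).
  have := origin_bounds s i; move: (origin s i 0) (n i 0) (_ ^+ _) => p v u; lia.
(* The letter at 0 is pinned to b, read at level 0, before letters are chosen at all positions. *)
have {}Ttot (n : 'cV[int]_d) : exists c, (n = 0 -> c = b) /\ exists s, T s (origin s + n, c).
  have [-> | n0] := eqVneq n 0; last first.
    have [s [c h]] := Ttot n; exists c; split; last by exists s.
    by move/eqP: n0.
  by exists b; split=> //; exists 0%N; rewrite /origin big_ord0 add0r.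
have [y hy] := choice Ttot.
have [z hz] := choice (fun n => (hy n).2).
exists y; last exact: (hy 0).1.
move=> S /finite_seqP[q ->].
pose s := \max_(n <- q) z n; exists s.*2, (iter s next b), (origin s) => n nq.
by apply: Tmon (hz n); rewrite /s; apply: leq_bigmax_seq.
Qed.

End Supertiles.

(** * Signed permutations and the induced map of R *)

Section SignedPermutations.
Context {d : nat}.

Lemma hyperoctahedral_mulmxT (M : 'M[int]_d) :
  hyperoctahedral d M -> M *m M^T = 1%:M.
Proof.
move=> [s [e ->]]; apply/matrixP => i j; rewrite !mxE (bigD1 (s i)) //= big1.
  rewrite !mxE eqxx addr0 (inj_eq perm_inj).
  by case: eqP => [->|]; rewrite ?mulr0 // -signr_addb addbb.
by move=> k /negPf ks; rewrite !mxE ks mul0r.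
Qed.

Lemma hyperoctahedral_tr (M : 'M[int]_d) :
  hyperoctahedral d M -> hyperoctahedral d M^T.
Proof.
move=> [s [e ->]]; exists (s^-1)%g, (fun i => e ((s^-1)%g i)).
apply/matrixP => i j; rewrite !mxE -{1}(permKV s i) (inj_eq perm_inj) eq_sym.
by case: eqP => // ->.
Qed.

Lemma hyperoctahedral_abs (M : 'M[int]_d) :
  hyperoctahedral d M -> hyperoctahedral d (absmx M).
Proof.
move=> [s [e ->]]; exists s, (fun=> false); apply/matrixP => i j.
by rewrite !mxE; case: eqP; rewrite ?normr0 // normrX normrN1 expr1n.
Qed.

Lemma ratmx_inj m n : injective (@ratmx m n).
Proof.
move=> M N /matrixP MN; apply/matrixP => i j.
by have := MN i j; rewrite !mxE => /intr_inj.
Qed.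

Context {L : 'I_d -> nat} {M : 'M[int]_d}.
Hypotheses (hM : hyperoctahedral d M) (hx1 : ratmx (absmx M) *m x1 L = x1 L).

Local Notation M1 := (block_symmetry hM hx1).

(** Both sides equal |M| x_1 - M x_1; comparing two indices keeps half-integral vectors out of the
    statement. *)
Lemma block_symmetry_offset i j :
  val (M1 i) - M *m val i = val (M1 j) - M *m val j.
Proof.
have E k : ratmx (val (M1 k) - M *m val k)
    = ratmx (absmx M) *m x1 L - ratmx M *m x1 L.
  rewrite /ratmx map_mxB map_mxM -/(ratmx (val (M1 k))) block_symmetryE mulmxBr.
  by rewrite -/(ratmx M) -/(ratmx (val k)) addrAC [_ - _ - _]addrAC subrr sub0r addrC.
by apply: ratmx_inj; rewrite !E.
Qed.

(** The map built from the transpose of [M] is a right inverse; it exists because |M| is orthogonal,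
    so its transpose fixes x_1 too. *)
Lemma block_symmetry_surj i : exists j, M1 j = i.
Proof.
have hx1T : ratmx (absmx M^T) *m x1 L = x1 L.
  rewrite -{1}hx1 mulmxA /ratmx -map_mxM.
  have -> : absmx M^T = (absmx M)^T by apply/matrixP => a b; rewrite !mxE.
  rewrite (mulmx1C (hyperoctahedral_mulmxT (hyperoctahedral_abs hM))).
  by rewrite map_mx1 mul1mx.
exists (block_symmetry (hyperoctahedral_tr hM) hx1T i).
apply/val_inj/ratmx_inj; rewrite !block_symmetryE hx1 hx1T addrK mulmxA.
by rewrite /ratmx -map_mxM hyperoctahedral_mulmxT // map_mx1 mul1mx subrK.
Qed.

End SignedPermutations.

(** Each coordinate of [f x] is a function of one coordinate of x, and the hull has the initial
    topology from a product of discrete spaces. *)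
Lemma hull_continuous {d : nat} {Al : finType} {L : 'I_d -> nat}
    {rho : Al -> block L -> Al} (f : hull rho -> hull rho)
    (h : 'cV[int]_d -> 'cV[int]_d) (u : Al -> Al) :
  (forall x n, val (f x) n = u (val x (h n))) -> continuous f.
Proof.
move=> fE; apply: continuous_comp_initial => x.
have F := fmap_filter (set_val \o f) (nbhs_filter x).
apply/cvg_sup => n U.
move=> [_ [[W oW <-]] /= Wx /filterS]; apply.
have evc : continuous (fun y : hull rho => (val y : config) (h n)
    : discrete_topology Al).
  move=> y; apply: (@continuous_comp _ (@config d Al) _ set_val
    (@proj _ (fun=> discrete_topology Al) (h n) : config -> discrete_topology Al)).
    exact: initial_continuous.
  exact: proj_continuous.
have : nbhs (val x (h n) : discrete_topology Al) [set a | W (u a)]%classic.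
  rewrite nbhs_principalE; apply/principal_filterP.
  by rewrite -[_ (_ _)]/(W (u (val x (h n)))) -fE.
move=> /evc Wnbhs.
apply: (@filterS _ (nbhs x) _ [set y | W (u (val y (h n)))]%classic) Wnbhs.
by move=> y; rewrite -[_ y]/(W (u (val y (h n)))) -fE.
Qed.

(** * From conjugate columns to an extended symmetry *)

Section Symmetry.
Context {d : nat} {Al : finType} {L : 'I_d -> nat}.
Variable rho : Al -> block L -> Al.
Hypothesis L_ge2 : forall i, (2 <= L i)%N.
Variables (M : 'M[int]_d) (pi : {perm Al}).
Hypotheses (hM : hyperoctahedral d M) (hx1 : ratmx (absmx M) *m x1 L = x1 L).
Hypothesis MQ : M *m Qmx L = Qmx L *m M.

Local Notation Q := (Qmx L).
Local Notation M1 := (block_symmetry hM hx1).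
Local Notation offset := (val (M1 (block0 L_ge2))).

Let MMT : M *m M^T = 1%:M := hyperoctahedral_mulmxT hM.
Let MTM : M^T *m M = 1%:M := mulmx1C MMT.

Lemma block_symmetryE_offset i : val (M1 i) = M *m val i + offset.
Proof.
have := block_symmetry_offset hM hx1 i (block0 L_ge2).
by rewrite mulmx0 subr0 => <-; rewrite addrC subrK.
Qed.

Lemma supertile_relabel :
  (forall a i, rho (pi a) i = pi (rho a (M1 i))) -> forall k,
  exists c, forall a n b,
    supertile rho k a (M *m n + c, b) <-> supertile rho k (pi a) (n, pi b).
Proof.
move=> piE; elim=> [|k [c IHk]].
  exists 0 => a n b; rewrite addr0; split=> -[n0 b0].
    by rewrite b0 -[n]mul1mx -MTM -mulmxA n0 mulmx0.
  by rewrite n0 mulmx0 (perm_inj b0).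
exists (Q *m c + offset) => a n b; have [m [r ->]] := block_decomposition L_ge2 n.
have -> : M *m (Q *m m + val r) + (Q *m c + offset)
    = Q *m (M *m m + c) + val (M1 r).
  by rewrite (block_symmetryE_offset r) !mulmxDr !mulmxA MQ addrACA.
split=> /inflateP[b' hb' e]; apply/inflateP.
  by exists (pi b'); [apply/IHk | rewrite piE e].
exists ((pi^-1)%g b'); first by apply/IHk; rewrite permKV.
by apply: (@perm_inj _ pi); rewrite -piE permKV.
Qed.

Lemma conjugate_columns_extended_symmetry :
  (forall a i, rho (pi a) i = pi (rho a (M1 i))) ->
  induces_extended_symmetry rho pi M.
Proof.
move=> /supertile_relabel srel.
have hull_f (x : @config d Al) : hull rho x -> hull rho (relabel pi M x).
  move=> hx S finS; have [k [a [t ht]]] := hx _ (finite_image (mulmx M) finS).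
  (* The new position s of the pattern solves M s + c = t. *)
  have [c hc] := srel k; exists k, (pi a), (M^T *m (t - c)) => n Sn.
  apply/hc; rewrite mulmxDr mulmxA MMT mul1mx addrAC subrK.
  by apply: ht; exists n.
have hull_g (x : @config d Al) :
    hull rho x -> hull rho (relabel (pi^-1)%g M^T x).
  move=> hx S finS; have [k [a [t ht]]] := hx _ (finite_image (mulmx M^T) finS).
  have [c hc] := srel k; exists k, ((pi^-1)%g a), (M *m t + c) => n Sn.
  rewrite addrAC -[n in M *m t + n]mul1mx -MMT -mulmxA -mulmxDr; apply/hc.
  by rewrite !permKV; apply: ht; exists n.
pose f (x : hull rho) : hull rho :=
  exist _ (relabel pi M (val x)) (mem_set (hull_f _ (set_valP x))).
pose g (x : hull rho) : hull rho :=
  exist _ (relabel (pi^-1)%g M^T (val x)) (mem_set (hull_g _ (set_valP x))).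
exists 0, f; split; last by move=> x; apply/funext => n; rewrite /shift add0r.
have fgE n : f \o hull_shift_map n \o g = hull_shift_map (M^T *m n).
  apply/funext => x; apply/val_inj/funext => k /=.
  by rewrite /relabel /shift /= permKV mulmxDr mulmxA MTM mul1mx.
exists g; split.
- exact: (@hull_continuous _ _ _ _ _ (mulmx M) pi).
- exact: (@hull_continuous _ _ _ _ _ (mulmx M^T) (pi^-1)%g).
- move=> x; apply/val_inj/funext => n.
  by rewrite /= /relabel permK mulmxA MMT mul1mx.
- move=> x; apply/val_inj/funext => n.
  by rewrite /= /relabel permKV mulmxA MTM mul1mx.
apply/seteqP; split=> [_ [_ [n _ <-] <-]|_ [n _ <-]].
  by exists (M^T *m n).
exists (hull_shift_map (M *m n)); first by exists (M *m n).
by rewrite fgE mulmxA MTM mul1mx.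
Qed.

(** * From an extended symmetry to conjugate columns *)

Hypothesis rho_bij : bijective_subst rho.
Hypothesis rho_aper : aperiodic rho.

(** Repeating the translation as often as the order of [th] cancels the relabelling and leaves a
    true period. *)
Lemma aperiodic_relabelled_translate (y : @config d Al) (e : 'cV[int]_d) (th : {perm Al}) :
  hull rho y -> (forall n, y (n + e) = th (y n)) -> e = 0.
Proof.
move=> hy ye.
have yke k n : y (n + e *+ k) = (th ^+ k)%g (y n).
  elim: k => [|k IHk]; first by rewrite addr0 perm1.
  by rewrite mulrSr addrA ye IHk expgSr permM.
have /(rho_aper hy) /colP e0 : shift (e *+ #[th]%g) y = y.
  by apply/funext => n; rewrite /shift addrC yke expg_order perm1.
apply/colP => i; have := e0 i; rewrite mulmxnE mxE => /eqP.
by rewrite mulrn_eq0 -leqn0 leqNgt order_gt0 => /eqP.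
Qed.

Lemma extended_symmetry_conjugate_columns b :
  induces_extended_symmetry rho pi M ->
  exists b', forall i, pi (rho b (M1 i)) = rho b' i.
Proof.
move=> [m [f [_ fE]]].
have [y hy y0] := hull_letter L_ge2 rho_bij b.
have [x xE] := subst_exists rho L_ge2 y.
have hx : hull rho x := hull_subst L_ge2 xE hy.
pose X : hull rho := exist _ x (mem_set hx).
have /(hull_desubst L_ge2 rho_bij)[t [y' y'E]] : hull rho (val (f X)).
  exact: set_valP.
(* At the digit r of block n of y', [f X] reads x at M (m + t) + Q M n + M r, where M r is M1 r
   minus [offset]; division by Q of the constant part leaves the phase [de]. *)
have [q [de deE]] := block_decomposition L_ge2 (M *m (m + t) - offset).
have {}y'E n r : pi (x (Q *m (M *m n + q) + (val (M1 r) + val de))) = rho (y' n) r.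
  rewrite -y'E fE /shift /relabel /=; congr (pi (x _)).
  rewrite [m + (t + _)]addrA [RHS]mulmxDr -[M *m (m + t)](subrK offset) deE.
  rewrite !mulmxDr !mulmxA MQ (block_symmetryE_offset r).
  by rewrite [LHS](AC (2*(2*1)) ((2*5*4)*(1*3))).
pose p r := perm (bij_inj (rho_bij r)).
have pE r a : p r a = rho a r by rewrite permE.
have de0 : val de = 0.
  apply: contrapT => de_neq0.
  have [i hi] : exists i, val de i 0 != 0.
    apply: contrapT => H; apply: de_neq0; apply/colP => i; rewrite mxE.
    by apply: contrapT => /eqP hi; apply: H; exists i.
  (* Adding [de] to the digits 0 and (L i - 1) e_i gives [de], respectively a carry
     e_i and the digit [de - e_i]. *)
  pose ei : 'cV[int]_d := delta_mx i 0.
  have s1P : in_block L (((L i)%:Z - 1) *: ei).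
    apply/forallP => j; rewrite !mxE eqxx andbT; have := L_ge2 j.
    by case: eqP => [->|_] /=; lia.
  have s2P : in_block L (val de - ei).
    apply/forallP => j; have := blockP de j; move: (val de) hi => v hi.
    by rewrite !mxE eqxx andbT; case: eqP => [->|_] /=; lia.
  have [r0 r0E] := block_symmetry_surj hM hx1 (block0 L_ge2).
  have [r1 r1E] := block_symmetry_surj hM hx1
    (exist (fun r : 'cV_d => in_block L r) _ s1P).
  pose s2 : block L := exist (fun r : 'cV_d => in_block L r) _ s2P.
  have E0 n : pi (rho (y (M *m n + q)) de) = rho (y' n) r0.
    by rewrite -y'E r0E add0r xE.
  have E1 n : pi (rho (y (M *m n + q + ei)) s2) = rho (y' n) r1.
    rewrite -y'E r1E -xE /= mulmxDr -addrA; congr (pi (x (_ + _))).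
    have -> : Q *m ei = (L i)%:Z *: ei.
      apply/colP => j; rewrite Qmx_mulE !mxE; case: eqP => [->|] //=.
      by rewrite !mulr0.
    by rewrite addrCA [RHS]addrC scalerBl scale1r; congr (_ + _).
  have : ei = 0.
    (* The product acts from left to right: by [E0] the first three factors turn a letter of y into
       one of y', and by [E1] the others turn that into the letter of y one step [ei] further. *)
    apply: (@aperiodic_relabelled_translate y ei
      (p de * pi * (p r0)^-1 * p r1 * pi^-1 * (p s2)^-1)%g) => // n.
    have [k ->] : exists k, n = M *m k + q.
      by exists (M^T *m (n - q)); rewrite mulmxA MMT mul1mx subrK.
    apply: (@perm_inj _ (p s2)); apply: (@perm_inj _ pi).
    rewrite !permM !permKV pE E1 -pE; congr (p r1 _).
    by apply: (@perm_inj _ (p r0)); rewrite permKV !pE E0.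
  by move=> /colP/(_ i); rewrite !mxE !eqxx.
(* This block of y' is the one for which M n + q = 0, so that x is read in the image of y 0 = b. *)
exists (y' (- (M^T *m q))) => i.
by rewrite -y'E mulmxN mulmxA MMT mul1mx addNr de0 addr0 xE y0.
Qed.

End Symmetry.

Theorem theorem30 (d : nat) (Al : finType) (L : 'I_d -> nat)
    (rho : Al -> block L -> Al)
    (L_ge2 : forall i, (2 <= L i)%N)
    (rho_aperiodic : aperiodic rho)
    (rho_primitive : primitive_subst rho)
    (rho_bijective : bijective_subst rho)
    (A : 'M[int]_d) (A_in_W : hyperoctahedral d A)
    (AQ_comm : A *m Qmx L = Qmx L *m A)
    (absA_x1 : ratmx (absmx A) *m x1 L = x1 L)
    (l : block L)
    (orbit_id : forall l' : block L,
       (exists k : nat, l' = iter k (block_symmetry A_in_W absA_x1) l) ->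
       column rho l' =1 id)
    (pi : {perm Al}) :
  induces_extended_symmetry rho pi A <->
  forall i : block L,
    (pi^-1)%g \o column rho i \o pi
      =1 column rho (block_symmetry A_in_W absA_x1 i).
Proof.
split=> [sym i a|piE]; last first.
  apply: (@conjugate_columns_extended_symmetry _ _ _ rho L_ge2 _ _ A_in_W absA_x1 AQ_comm).
  by move=> a i; have := piE i a => /= /(canRL (permKV pi)).
have [b bE] := extended_symmetry_conjugate_columns L_ge2 A_in_W absA_x1 AQ_comm
  rho_bijective rho_aperiodic a sym.
have pia : pi a = b.
  have := bE l; have -> : rho b l = b by apply: (orbit_id l); exists 0%N.
  by rewrite [rho a _]orbit_id //; exists 1%N.
by rewrite /= pia /column -bE permK.
Qed.
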